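(* Every profinite lattice is algebraic. In particular, for every positive integer $n$, $\mathrm{WO}(\mathrm{Tot})$ and $\mathrm{WO}(\mathrm{TTot}_n)$ are algebraic lattices.
   Context: A complete lattice congruence on a complete lattice $L$ is an equivalence relation $\equiv$ such that $x_i\equiv y_i$ for all $i\in I$ ($I$ any index set) implies $\bigvee_i x_i\equiv\bigvee_i y_i$ and $\bigwedge_i x_i\equiv\bigwedge_i y_i$. It is cofinite if the quotient $L/{\equiv}$ is finite. A complete lattice $L$ is profinite if for all $x\neq y$ in $L$ there is a cofinite complete lattice congruence $\equiv$ on $L$ with $x\not\equiv y$. An element $x$ of a complete lattice $L$ is compact if for any $X\subseteq L$ with $x\le\bigvee X$ there is a finite $X'\subseteq X$ with $x\le\bigvee X'$. $L$ is algebraic if every element of $L$ is the join of a set of compact elements. $\mathrm{Tot}$ is the set of all (strict) total orders $\prec$ on $\mathbb{Z}$; $<$ denotes the usual order. $N(\prec)$ is the set of pairs $(a,b)$ with $a<b$ and $b\prec a$. $\mathrm{WO}(\mathrm{Tot})$ is $\mathrm{Tot}$ partially ordered by $(\prec_1)\le(\prec_2)$ iff $N(\prec_1)\subseteq N(\prec_2)$. $\mathrm{TTot}_n\subseteq \mathrm{Tot}$ is the set of total orders $\prec$ such that for all $a,b$: $a\prec b$ iff $a+n\prec b+n$; $\mathrm{WO}(\mathrm{TTot}_n)$ is $\mathrm{TTot}_n$ with the induced order. *)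

(* Defs.v *)
From HB Require Import structures.
From mathcomp Require Import all_boot all_order all_algebra.
From mathcomp Require Import boolp classical_sets cardinality.

Set Implicit Arguments.
Unset Strict Implicit.
Unset Printing Implicit Defensive.

Import Order.TTheory GRing.Theory Num.Theory.
Local Open Scope classical_set_scope.
Local Open Scope ring_scope.
Local Open Scope order_scope.

Section CompleteLattices.
Variables (d : Order.disp_t) (L : porderType d).

Definition complete_lattice : Prop :=
  forall A : set L, supremums A !=set0 /\ infimums A !=set0.

(* Suprema and infima are unique when they exist, so the joins and meets of
   the families x and y are named by quantifying over their values. *)
Definition complete_congruence (e : equiv_rel L) : Prop :=
  forall (I : Type) (x y : I -> L), (forall i, e (x i) (y i)) ->
    (forall s t, supremums (range x) s -> supremums (range y) t -> e s t) /\
    (forall s t, infimums (range x) s -> infimums (range y) t -> e s t).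

Definition cofinite (e : equiv_rel L) : Prop :=
  finite_set [set: {eq_quot e}%qT].

Definition profinite_lattice : Prop :=
  complete_lattice /\
  forall x y : L, x <> y ->
    exists e : equiv_rel L, [/\ complete_congruence e, cofinite e & ~~ e x y].

Definition compact_element (x : L) : Prop :=
  forall (X : set L) (s : L), supremums X s -> x <= s ->
    exists X' : set L, [/\ finite_set X', X' `<=` X &
      exists2 s' : L, supremums X' s' & x <= s'].

Definition algebraic_lattice : Prop :=
  complete_lattice /\
  forall x : L, exists2 K : set L, K `<=` compact_element & supremums K x.

End CompleteLattices.

Definition strict_total_order (T : eqType) (r : rel T) : Prop :=
  [/\ irreflexive r, transitive r & forall a b, a != b -> r a b || r b a].

Record Tot := MkTot {
  tot_rel :> rel int;
  tot_relP : strict_total_order tot_rel }.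

HB.instance Definition _ := gen_eqMixin Tot.
HB.instance Definition _ := gen_choiceMixin Tot.

Definition inversions (r : Tot) : set (int * int) :=
  [set p | (p.1 < p.2)%R /\ r p.2 p.1].

Lemma inversions_inj : injective inversions.
Proof.
move=> r s Nrs.
have inv a b : (a < b)%R -> r b a = s b a.
  move=> ab; apply/idP/idP => h.
    by have [] : inversions s (a, b) by rewrite -Nrs.
  by have [] : inversions r (a, b) by rewrite Nrs.
have asym (q : Tot) a b : (a < b)%R -> q a b = ~~ q b a.
  move=> ab; have [irr tr tot] := tot_relP q; apply/idP/idP => [qab|nqba].
    by apply/negP => qba; have := tr _ _ _ qab qba; rewrite irr.
  by have := tot a b; rewrite lt_eqF // (negbTE nqba) orbF; apply.
have rs : tot_rel r = tot_rel s.
  apply/funext => a; apply/funext => b; case: (ltgtP a b) => [ab|ba|->].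
  - by rewrite (asym r) // (asym s) // inv.
  - exact: inv.
  - by have [-> _ _] := tot_relP r; have [-> _ _] := tot_relP s.
case: r s rs {Nrs inv} => [r rP] [s sP] /= rs; rewrite {}rs in rP *.
by rewrite (Prop_irrelevance rP sP).
Qed.

Fact weak_order_display : Order.disp_t. Proof. exact: (Order.Disp tt tt). Qed.

Definition weak_le (r s : Tot) : bool := `[< inversions r `<=` inversions s >].

Lemma weak_le_refl : reflexive weak_le.
Proof. by move=> r; apply/asboolP. Qed.

Lemma weak_le_anti : antisymmetric weak_le.
Proof.
move=> r s /andP[/asboolP rs /asboolP sr].
by apply: inversions_inj; apply/seteqP.
Qed.

Lemma weak_le_trans : transitive weak_le.
Proof.
by move=> s r t /asboolP rs /asboolP st; apply/asboolP; apply: subset_trans st.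
Qed.

HB.instance Definition _ := Order.Le_isPOrder.Build weak_order_display Tot
  weak_le_refl weak_le_anti weak_le_trans.

Definition translation_invariant (n : nat) (r : rel int) : Prop :=
  forall a b : int, r a b <-> r (a + n%:Z)%R (b + n%:Z)%R.

Record TTot (n : nat) := MkTTot {
  ttot_val :> Tot;
  ttot_valP : `[< translation_invariant n ttot_val >] }.

HB.instance Definition _ n := [isSub for @ttot_val n].
HB.instance Definition _ n := [Choice of TTot n by <:].
HB.instance Definition _ n :=
  [SubChoice_isSubPOrder of TTot n by <: with weak_order_display].

(* Main.v *)
(** The least element of a class of a cofinite complete congruence is compact:
    if it lies below a join, then replacing the joinands by finitely many class
    representatives changes the join only within its class.  In a profinite
    lattice every element is the join of the least elements of its classes.

    The inversion set of a join in the weak order is the transitive closure of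
    the union of the inversion sets, and dually for meets.  A chain between [a]
    and [b] stays in the interval between them, so agreeing on a given
    finite interval of integers is a cofinite complete congruence.  Joins and
    meets of translation-invariant orders are translation invariant, so these
    congruences restrict to [TTot n]. *)

Require Import Defs.
From mathcomp Require Import all_boot all_order all_algebra.
From mathcomp Require Import boolp classical_sets cardinality.
From mathcomp Require Import zify.
From Stdlib Require Import Relation_Operators.

Set Implicit Arguments.
Unset Strict Implicit.
Unset Printing Implicit Defensive.

Import Order.TTheory GRing.Theory Num.Theory.

(** * Cofinite congruences and compact elements *)

Section Profinite.
Local Open Scope classical_set_scope.
Local Open Scope order_scope.
Variables (d : Order.disp_t) (L : porderType d).

Lemma supremums_pair (x y : L) : x <= y ->
  supremums (range (fun b : bool => if b then x else y)) y.
Proof.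
move=> xy; split => [_ [[] _ <-] //|u]; apply; exact: imageT false.
Qed.

Lemma infimums_pair (x y : L) : x <= y ->
  infimums (range (fun b : bool => if b then x else y)) x.
Proof.
move=> xy; split => [_ [[] _ <-] //|u]; apply; exact: imageT true.
Qed.

Section Congruence.
Variable e : equiv_rel L.
Hypothesis eC : complete_congruence e.

(** Meeting [y] and [s] with [c] gives congruent results, and the meet of [c] and [s] is [c]. *)
Lemma congruence_meet (c y s m : L) :
  e y s -> c <= s -> infimums (range (fun b : bool => if b then c else y)) m ->
  e m c.
Proof.
move=> eys cs mI; have [] := @eC bool (fun b => if b then c else y)
  (fun b => if b then c else s); first by case=> //=; exact: equiv_refl.
by move=> _ /(_ _ _ mI (infimums_pair cs)).
Qed.

(** Meeting both sides of [e x z] with [y] yields [x] and [y]. *)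
Lemma congruence_convex (x y z : L) : e x z -> x <= y -> y <= z -> e x y.
Proof.
move=> exz xy yz; have [] := @eC bool (fun b => if b then x else y)
  (fun b => if b then z else y); first by case=> //=; exact: equiv_refl.
move=> _; apply; first exact: infimums_pair.
by split => [_ [[] _ <-] //|u]; apply; exact: imageT false.
Qed.

(** The constant family [x] and the family of all members of its class are congruent termwise, hence
    so are their meets. *)
Lemma congruence_class_min (x m : L) :
  infimums [set y | e x y] m -> e x m.
Proof.
move=> mI; have [] := @eC {y | e x y} (fun=> x) (fun y => sval y).
  by case.
move=> _; apply.
- split=> [_ [? _ <-] //|u]; apply.
  by exists (exist (fun y => e x y) x (equiv_refl e x)).
- rewrite (_ : range _ = [set y | e x y]) //.
  apply/seteqP; split => [_ [[y exy] _ <-] //|y exy].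
  by exists (exist (fun y => e x y) y exy).
Qed.

Lemma compact_class_min (x m : L) : complete_lattice L -> cofinite e ->
  infimums [set y | e x y] m -> compact_element m.
Proof.
move=> cL fin mI X s sX ms.
pose pi z := \pi_({eq_quot e})%qT z.
have piE y z : (pi y = pi z) <-> e y z by split=> /eqmodP.
(* [g] picks in [X] one member of each class that meets [X]; on other classes its value is
   arbitrary. *)
have /choice[g gP] : forall q, exists y, (pi @` X) q -> X y /\ pi y = q.
  move=> q; have [[y Xy yq]|nq] := pselect ((pi @` X) q); last by exists x.
  by exists y.
have Xg : g @` (pi @` X) `<=` X by move=> _ [q /gP[? _] <-].
exists (g @` (pi @` X)); split=> //.
  by apply: finite_image; apply: sub_finite_set fin.
have [s' s'X] := (cL (g @` (pi @` X))).1.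
exists s' => //.
(* Both joins are indexed by [X], each member being paired with the representative of its class. *)
have es's : e s' s.
  have [] := @eC {y | X y} (fun y => g (pi (sval y))) (fun y => sval y).
    case=> y Xy /=; apply/piE.
    by have [] := gP (pi y) (imageP _ Xy).
  move=> + _; apply.
    rewrite [Z in supremums Z](_ : _ = g @` (pi @` X)) //; apply/seteqP; split.
      by move=> _ [[y Xy] _ <-] /=; do 2!apply: imageP.
    by move=> _ [_ [y Xy <-] <-]; exists (exist X y Xy).
  rewrite (_ : range _ = X) //; apply/seteqP; split; first by move=> _ [[]] ? ? _ <-.
  by move=> y Xy; exists (exist X y Xy).
(* The meet [k] of [m] and [s'] is congruent to [m], so it lies in the class of [x] and above the
   minimum [m]. *)
have [k kI] := (cL (range (fun b : bool => if b then m else s'))).2.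
have ekm := congruence_meet es's ms kI.
have mk : m <= k.
  apply: mI.1; apply: (equiv_trans (congruence_class_min mI)).
  by rewrite equiv_sym.
by apply: le_trans mk _; apply: kI.1; exact: imageT false.
Qed.

End Congruence.

Lemma profinite_algebraic : profinite_lattice L -> algebraic_lattice L.
Proof.
move=> [cL sep]; split=> // x.
pose K := [set m : L | exists e : equiv_rel L,
  [/\ complete_congruence e, cofinite e & infimums [set y | e x y] m]].
exists K => [m [e [eC fin mI]]|]; first exact: compact_class_min mI.
have [y yK] := (cL K).1.
have yx : y <= x.
  by apply: yK.2 => m [e [eC _ mI]]; apply: mI.1; exact: equiv_refl.
have [<- //|/sep[e [eC fin]]] := pselect (y = x).
have [m mI] := (cL [set y | e x y]).2.
have exm := congruence_class_min eC mI.
have my : m <= y by apply: yK.1; exists e.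
have emx : e m x by rewrite equiv_sym.
(* Since [m <= y <= x] with [m] and [x] congruent, [y] falls into the class that [e] was chosen to
   keep it out of. *)
by rewrite equiv_sym (equiv_trans exm) // (congruence_convex eC emx).
Qed.

End Profinite.

(** * Transitive closures of relations *)

Section ClosTrans.
Variables (S T : Type) (U : S -> S -> Prop) (V : T -> T -> Prop).

Lemma clos_trans_map (h : S -> T) :
  (forall a b, U a b -> V (h a) (h b)) ->
  forall a b, clos_trans S U a b -> clos_trans T V (h a) (h b).
Proof.
move=> UV a b; elim=> {a b} [a b Uab|a b c _ ab _ bc].
  by apply: t_step; exact: UV.
exact: t_trans bc.
Qed.

Lemma clos_trans_least :
  (forall a b c, U a b -> U b c -> U a c) ->
  forall a b, clos_trans S U a b -> U a b.
Proof. by move=> Utr a b; elim=> // {}a {}b c _ ab _; exact: Utr. Qed.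

End ClosTrans.

(** * Inversions and reversal of total orders on the integers *)

Section WeakOrder.
Local Open Scope ring_scope.
Implicit Types (r s t : Tot) (a b c u v : int).

Lemma tot_asym r a b : a != b -> r a b = ~~ r b a.
Proof.
have [irr tr tot] := tot_relP r => ab; apply/idP/idP => [rab|nrba].
  by apply/negP => rba; have := tr _ _ _ rab rba; rewrite irr.
by have := tot a b ab; rewrite (negbTE nrba) orbF.
Qed.

Lemma rev_tot_subproof r : strict_total_order (fun a b => r b a).
Proof.
have [irr tr tot] := tot_relP r.
split => [a|b a c ab bc|a b ab]; first exact: irr.
- exact: tr bc ab.
- by rewrite orbC tot.
Qed.

Definition rev_tot r := MkTot (rev_tot_subproof r).

Lemma rev_totK : involutive rev_tot.
Proof. by move=> r; apply: inversions_inj. Qed.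

Definition inv r a b : Prop := a < b /\ r b a.

Lemma weak_leP r s :
  reflect (forall a b, inv r a b -> inv s a b) (r <= s)%O.
Proof.
apply: (iffP (asboolP _)) => [rs a b|rs [a b]]; first exact: (rs (a, b)).
exact: rs.
Qed.

(** Reversal complements the inversion set within the pairs [a < b]. *)
Lemma weak_le_rev r s : (rev_tot r <= rev_tot s)%O = (s <= r)%O.
Proof.
have H t t' : (t <= t')%O -> (rev_tot t' <= rev_tot t)%O.
  move=> /weak_leP tt'; apply/weak_leP => a b [ab /= t'ab]; split=> //=.
  rewrite tot_asym ?lt_eqF //; apply/negP => tba.
  have [] := tt' a b (conj ab tba); rewrite tot_asym ?t'ab //.
  by rewrite gt_eqF.
by apply/idP/idP => /H //; rewrite !rev_totK.
Qed.

Lemma inv_lt r a b : inv r a b -> a < b. Proof. by case. Qed.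

Lemma inv_trans r a b c : inv r a b -> inv r b c -> inv r a c.
Proof.
have [_ tr _] := tot_relP r.
by move=> [ab rba] [bc rcb]; split; [exact: lt_trans bc|exact: tr rba].
Qed.

(** If [b] does not precede [a] in [r], then [r] lists the three as [c], [a], [b]. *)
Lemma inv_cotrans r a b c :
  inv r a c -> a < b -> b < c -> inv r a b \/ inv r b c.
Proof.
have [_ tr _] := tot_relP r; move=> [ac rca] ab bc.
have [rba|nrba] := boolP (r b a); first by left.
right; split=> //; apply: tr rca _.
by rewrite tot_asym ?lt_eqF.
Qed.

(** * Total orders with a prescribed inversion set *)

Section TotOfInversions.
Variable N : int -> int -> Prop.
Hypothesis N_lt : forall a b, N a b -> a < b.
Hypothesis N_trans : forall a b c, N a b -> N b c -> N a c.
Hypothesis N_cotrans :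
  forall a b c, N a c -> a < b -> b < c -> N a b \/ N b c.

(** Converse to [inv_lt], [inv_trans] and [inv_cotrans]: these properties characterize inversion
    sets. *)
Lemma tot_of_inversions : exists t : Tot, forall a b, inv t a b <-> N a b.
Proof.
pose r a b := `[< N b a \/ (a < b /\ ~ N a b) >].
have rP : strict_total_order r.
  split => [a|y x z /asboolP xy /asboolP yz|a b].
  - by apply/asboolP => -[/N_lt|[]]; rewrite ltxx.
  (* Two swapped pairs compose by [N_trans], two kept pairs by [N_cotrans]; a mixed case depends on
     how [x] and [z] compare. *)
  - apply/asboolP; case: xy yz => [Nyx|[xy nxy]] [Nzy|[yz nyz]].
    + by left; exact: N_trans Nyx.
    + have yx := N_lt Nyx; case: (ltgtP x z) => [xz|zx|xz].
      * by right; split=> // Nxz; apply: nyz; exact: N_trans Nxz.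
      * by left; have [] := N_cotrans Nyx yz zx.
      * by case: nyz; rewrite -xz.
    + have zy := N_lt Nzy; case: (ltgtP x z) => [xz|zx|xz].
      * by right; split=> // Nxz; apply: nxy; exact: N_trans Nzy.
      * by left; have [] := N_cotrans Nzy zx xy.
      * by case: nxy; rewrite xz.
    + right; split; first exact: lt_trans yz.
      by move=> Nxz; have [] := N_cotrans Nxz xy yz.
  - case: (ltgtP a b) => // ab _.
      have [Nab|nab] := pselect (N a b); apply/orP.
        by right; apply/asboolP; left.
      by left; apply/asboolP; right.
    have [Nab|nab] := pselect (N b a); apply/orP.
      by left; apply/asboolP; left.
    by right; apply/asboolP; right.
exists (MkTot rP) => a b; split.
  by case=> ab /asboolP [//|[ba]]; rewrite ltNge (ltW ab) in ba.
by move=> Nab; split; [exact: N_lt|apply/asboolP; left].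
Qed.

End TotOfInversions.

(** * Joins in the weak order *)

Definition inv_union (A : set Tot) a b : Prop := exists2 r, A r & inv r a b.

(* Reversing all orders exchanges joins and meets, so a meet is described by
   applying this specification to the reversed orders. *)
Definition weak_join_spec (A : set Tot) t : Prop :=
  forall a b, inv t a b <-> clos_trans int (inv_union A) a b.

Lemma clos_inv_lt (A : set Tot) a b :
  clos_trans int (inv_union A) a b -> a < b.
Proof.
elim=> {a b} [a b [r _ /inv_lt //]|a b c _ ab _]; exact: lt_trans.
Qed.

(** The point at issue is cotransitivity of the closure: an integer between the ends of a chain is a
    vertex of it or falls inside one link, which [inv_cotrans] splits. *)
Lemma weak_join_exists (A : set Tot) : exists t, weak_join_spec A t.
Proof.
apply: tot_of_inversions => [a b|a b c ab bc|a b c ac].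
- exact: clos_inv_lt.
- exact: t_trans bc.
move: ac b; elim=> {a c} [a c [r Ar ac] b ab bc|a c e ac IHac ce IHce b ab be].
  by have [|] := inv_cotrans ac ab bc => ?; [left|right]; apply: t_step; exists r.
case: (ltgtP b c) => [bc|cb|->]; last by left.
  have [|h] := IHac _ ab bc; first by left.
  by right; apply: t_trans ce.
have [h|] := IHce _ cb be; last by right.
by left; apply: t_trans h.
Qed.

Lemma weak_join_ub (A : set Tot) r t : weak_join_spec A t -> A r -> (r <= t)%O.
Proof.
by move=> tA Ar; apply/weak_leP => a b rab; apply/tA/t_step; exists r.
Qed.

(** The inversions of an upper bound form a transitive relation, so they contain the closure. *)
Lemma weak_join_least (A : set Tot) t s : weak_join_spec A t ->
  (forall r, A r -> (r <= s)%O) -> (t <= s)%O.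
Proof.
move=> tA As; apply/weak_leP => a b /tA ab.
apply: (clos_trans_least (@inv_trans s)).
by apply: (clos_trans_map (h := id)) ab => {}a {}b [r /As/weak_leP]; apply.
Qed.

(** * Agreement of orders on an interval *)

Definition agree u v r s : Prop :=
  forall a b, u <= a <= v -> u <= b <= v -> r a b = s a b.

Lemma agree_rev u v r s : agree u v r s -> agree u v (rev_tot r) (rev_tot s).
Proof. by move=> rs a b au bv; exact: rs. Qed.

(** By totality, the inversions inside the interval determine every comparison there. *)
Lemma agree_inv u v r s :
  (forall a b, u <= a -> b <= v -> inv r a b <-> inv s a b) -> agree u v r s.
Proof.
move=> rs.
have H a b : u <= a -> a < b -> b <= v -> r b a = s b a.
  move=> ua ab bv; apply/idP/idP => h.
    by have [+ _] := rs a b ua bv; case.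
  by have [_ +] := rs a b ua bv; case.
move=> a b /andP[ua av] /andP[ub bv]; case: (ltgtP a b) => [ab|ba|->].
- by rewrite tot_asym ?lt_eqF // (tot_asym s) ?lt_eqF // H.
- exact: H.
- by have [-> _ _] := tot_relP r; have [-> _ _] := tot_relP s.
Qed.

(* A chain witnessing an inversion of the join stays between its endpoints. *)
Lemma clos_inv_agree u v (A B : set Tot) a b :
  (forall r, A r -> exists2 s, B s & agree u v r s) ->
  u <= a -> b <= v ->
  clos_trans int (inv_union A) a b -> clos_trans int (inv_union B) a b.
Proof.
move=> AB + + ab; elim: ab => {a b} [a b [r Ar [ab rba]] ua bv|a b c].
  have [s Bs rs] := AB r Ar; apply: t_step; exists s => //; split=> //.
  by rewrite -rs // ?ua ?bv ?(ltW (lt_le_trans ab bv)) ?(ltW (le_lt_trans ua ab)).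
move=> ab IHab bc IHbc ua cv.
have := clos_inv_lt ab; have := clos_inv_lt bc => b_c a_b.
apply: t_trans (IHbc _ cv); first by apply: IHab => //; lia.
by lia.
Qed.

Lemma weak_join_agree u v (A B : set Tot) s t :
  weak_join_spec A s -> weak_join_spec B t ->
  (forall r, A r -> exists2 r', B r' & agree u v r r') ->
  (forall r, B r -> exists2 r', A r' & agree u v r r') ->
  agree u v s t.
Proof.
move=> sA tB AB BA; apply: agree_inv => a b ua bv; split.
  by move/sA => h; apply/tB; exact: clos_inv_agree AB ua bv h.
by move/tB => h; apply/sA; exact: clos_inv_agree BA ua bv h.
Qed.

End WeakOrder.

(** * Posets embedded in [Tot] with joins and meets computed there *)

Section CompleteSublattice.
Local Open Scope classical_set_scope.
Variables (d : Order.disp_t) (L : porderType d) (f : L -> Tot).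
Hypothesis f_le : forall x y, (x <= y)%O = (f x <= f y)%O.
Hypothesis f_join : forall A : set L, exists s, weak_join_spec (f @` A) (f s).
Hypothesis f_meet : forall A : set L, exists s,
  weak_join_spec ((rev_tot \o f) @` A) (rev_tot (f s)).

Lemma supremums_weak_join (A : set L) s :
  weak_join_spec (f @` A) (f s) -> supremums A s.
Proof.
move=> sA; split=> [x Ax|u uA]; rewrite f_le.
  by apply: weak_join_ub sA _; exists x.
by apply: weak_join_least sA _ => _ [x /uA + <-]; rewrite f_le.
Qed.

Lemma infimums_weak_join (A : set L) s :
  weak_join_spec ((rev_tot \o f) @` A) (rev_tot (f s)) -> infimums A s.
Proof.
move=> sA; split=> [x Ax|u uA]; rewrite f_le -weak_le_rev.
  by apply: weak_join_ub sA _; exists x.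
by apply: weak_join_least sA _ => _ [x /uA + <-]; rewrite f_le /= weak_le_rev.
Qed.

Section Agreement.
Variables u v : int.

Definition agreeb (x y : L) : bool := `[< agree u v (f x) (f y) >].

Lemma agreeb_equiv : equiv_class_of agreeb.
Proof.
split=> [x|x y|y x z /asboolP xy /asboolP yz]; first exact/asboolP.
  by apply/asboolP/asboolP => xy a b ha hb; rewrite xy.
by apply/asboolP => a b ha hb; rewrite xy ?yz.
Qed.

Definition agree_equiv : equiv_rel L := EquivRelPack agreeb_equiv.

Lemma agree_equiv_complete : complete_congruence agree_equiv.
Proof.
move=> I x y xy; split=> s t sx ty.
- have [s' s'P] := f_join (range x); have [t' t'P] := f_join (range y).
  (* Suprema are unique, so the given ones are those computed in [Tot]. *)
  have := is_subset1_supremums (supremums_weak_join s'P) sx => ss'.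
  have := is_subset1_supremums (supremums_weak_join t'P) ty => tt'.
  subst s' t'; apply/asboolP; apply: weak_join_agree s'P t'P _ _.
    move=> _ [_ [i _ <-] <-]; exists (f (y i)); first by do 2!apply: imageP.
    exact/asboolP/xy.
  move=> _ [_ [i _ <-] <-]; exists (f (x i)); first by do 2!apply: imageP.
  by apply/asboolP; have := xy i; rewrite equiv_sym.
- have [s' s'P] := f_meet (range x); have [t' t'P] := f_meet (range y).
  have := is_subset1_infimums (infimums_weak_join s'P) sx => ss'.
  have := is_subset1_infimums (infimums_weak_join t'P) ty => tt'.
  subst s' t'; apply/asboolP.
  (* Reversal preserves agreement, which turns the meets into joins of reversed orders. *)
  suff /agree_rev : agree u v (rev_tot (f s)) (rev_tot (f t)) by [].
  apply: weak_join_agree s'P t'P _ _.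
    move=> _ [_ [i _ <-] <-]; exists (rev_tot (f (y i))).
      by exists (y i) => //; exact: imageP.
    exact/agree_rev/asboolP/xy.
  move=> _ [_ [i _ <-] <-]; exists (rev_tot (f (x i))).
    by exists (x i) => //; exact: imageP.
  by apply/agree_rev/asboolP; have := xy i; rewrite equiv_sym.
Qed.

(** A class is determined by the finite table of comparisons among the integers [u + i] with
    [i < n]. *)
Lemma agree_equiv_cofinite : cofinite agree_equiv.
Proof.
(* Both endpoints count, hence the successor; for [v < u] the interval is empty and any table
   serves. *)
pose n := `|v - u|%N.+1.
pose g (q : {eq_quot agree_equiv}%qT) : {ffun 'I_n * 'I_n -> bool} :=
  [ffun p : 'I_n * 'I_n => f (repr q) (u + p.1%:Z)%R (u + p.2%:Z)%R].
rewrite /cofinite -(preimage_setT g).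
apply: finite_preimage; last exact: finite_finset.
move=> p q _ _ pq; rewrite -[p]reprK -[q]reprK; apply/eqmodP/asboolP => a b.
move=> ha hb.
have an : (`|a - u| < n)%N by lia.
have bn : (`|b - u| < n)%N by lia.
have /ffunP/(_ (Ordinal an, Ordinal bn)) := pq; rewrite !ffunE /=.
have -> : (u + `|a - u|%N%:Z)%R = a by lia.
by have -> : (u + `|b - u|%N%:Z)%R = b by lia.
Qed.

End Agreement.

Lemma profinite_weak_sublattice : profinite_lattice L.
Proof.
split=> [A|x y xy].
  have [s /supremums_weak_join sA] := f_join A.
  have [t /infimums_weak_join tA] := f_meet A.
  by split; [exists s|exists t].
have [a [b ab]] : exists a b, f x a b <> f y a b.
  apply: contrapT => nxy; apply: xy; apply/le_anti; rewrite !f_le.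
  have H a b : f x a b = f y a b.
    by apply: contrapT => h; apply: nxy; exists a, b.
  by apply/andP; split; apply/weak_leP => a b [ab]; split=> //; rewrite ?H // -H.
(* The smallest interval containing both integers on whose comparison the orders differ. *)
exists (agree_equiv (Num.min a b) (Num.max a b)); split.
- exact: agree_equiv_complete.
- exact: agree_equiv_cofinite.
- by apply/asboolP => h; apply: ab; apply: h; lia.
Qed.

End CompleteSublattice.

Lemma profinite_Tot : profinite_lattice Tot.
Proof.
apply: (@profinite_weak_sublattice _ _ id) => // A.
  by rewrite image_id; exact: weak_join_exists.
have [t tA] := weak_join_exists (rev_tot @` A)%classic.
by exists (rev_tot t); rewrite rev_totK.
Qed.

(** * Translation-invariant orders *)

Section TranslationInvariant.
Local Open Scope ring_scope.
Variable n : nat.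

(** The shift preserves [<], so totality reduces invariance to inversions, the form that passes to
    transitive closures. *)
Lemma translation_invariant_inv (t : Tot) : translation_invariant n t <->
  forall a b, inv t a b <-> inv t (a + n%:Z) (b + n%:Z).
Proof.
split=> [tn a b|tn a b]; first by rewrite /inv ltrD2r; split=> -[? /(tn b a)].
have H (c e : int) : c < e -> t e c = t (e + n%:Z) (c + n%:Z).
  move=> ce; apply/idP/idP => h; first by have [+ _] := tn c e; case.
  by have [_ +] := tn c e; case=> //; split=> //; rewrite ltrD2r.
case: (ltgtP a b) => [ab|ba|->].
- by rewrite tot_asym ?lt_eqF // H // -tot_asym // lt_eqF // ltrD2r.
- by rewrite H.
- by have [irr _ _] := tot_relP t; rewrite !irr.
Qed.

Lemma translation_invariant_rev (t : Tot) :
  translation_invariant n t -> translation_invariant n (rev_tot t).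
Proof. by move=> tn a b; exact: tn. Qed.

(** Shifting by [n] carries a chain of inversions to another one link by link, and shifting by [-n]
    carries it back. *)
Lemma translation_invariant_join (A : set Tot) t :
  (forall r, A r -> translation_invariant n r) ->
  weak_join_spec A t -> translation_invariant n t.
Proof.
move=> An tA; apply/translation_invariant_inv => a b; rewrite !tA; split.
  apply: (clos_trans_map (h := fun c => c + n%:Z)) => c e [r Ar rce].
  have /translation_invariant_inv rn := An r Ar; exists r => //.
  exact: (rn c e).1.
move=> h; rewrite -[a](addrK n%:Z) -[b](addrK n%:Z).
apply: (clos_trans_map (h := fun c => c - n%:Z)) h => c e [r Ar rce].
have /translation_invariant_inv rn := An r Ar; exists r => //.
by apply: (rn _ _).2; rewrite !subrK.
Qed.

Lemma profinite_TTot : profinite_lattice (TTot n).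
Proof.
have An (x : TTot n) : translation_invariant n x by apply/asboolP/ttot_valP.
apply: (@profinite_weak_sublattice _ _ (@ttot_val n)) => // A.
  have [t tA] := weak_join_exists (@ttot_val n @` A)%classic.
  have tn : translation_invariant n t.
    by apply: translation_invariant_join tA => _ [x _ <-].
  by exists (MkTTot (asboolT tn)).
have [t tA] := weak_join_exists ((rev_tot \o @ttot_val n) @` A)%classic.
have tn : translation_invariant n (rev_tot t).
  apply: translation_invariant_rev; apply: translation_invariant_join tA.
  by move=> _ [x _ <-]; exact: translation_invariant_rev.
by exists (MkTTot (asboolT tn)); rewrite /= rev_totK.
Qed.

End TranslationInvariant.

Theorem corollary5p10 :
  (forall (d : Order.disp_t) (L : porderType d),
     profinite_lattice L -> algebraic_lattice L) /\
  (forall n : nat, 0 < n ->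
     algebraic_lattice Tot /\ algebraic_lattice (TTot n)).
Proof.
split=> [d L|n _]; first exact: profinite_algebraic.
split; apply: profinite_algebraic.
  exact: profinite_Tot.
exact: profinite_TTot.
Qed.
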